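(* For simplicial sets $X$ and $Y$, let $$\Delta_{X,Y}\colon\mathbb Z(X\times Y)_*\to\mathbb ZX_*\otimes\mathbb ZY_*,\qquad \nabla_{X,Y}\colon\mathbb ZX_*\otimes\mathbb ZY_*\to\mathbb Z(X\times Y)_*$$ be the Alexander–Whitney map and the shuffle map. Then there is a natural family of chain homotopies $$\{P_{X,Y}\colon\nabla_{X,Y}\circ\Delta_{X,Y}\simeq\mathrm{id}_{\mathbb Z(X\times Y)_*}\mid X \text{ and } Y \text{ are simplicial sets}\}$$ which is uniformly controlled by a function $\delta_{\mathrm{EZ}}(k)$. Furthermore, for $k\le4$ its values are $$\delta_{\mathrm{EZ}}(0)=0,\quad\delta_{\mathrm{EZ}}(1)=1,\quad\delta_{\mathrm{EZ}}(2)=4,\quad\delta_{\mathrm{EZ}}(3)=11,\quad\delta_{\mathrm{EZ}}(4)=26.$$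
   Context: For a simplicial set $X$ with face maps $d_i$ and degeneracy maps $s_i$, $\mathbb ZX_*$ is the (unnormalized) Moore complex: $\mathbb ZX_n$ is the free abelian group on the set $X_n$ of $n$-simplices, based by $X_n$, with $\partial\sigma=\sum_i(-1)^id_i\sigma$. The product is $(X\times Y)_n=X_n\times Y_n$ with $\sigma\times\tau:=(\sigma,\tau)$ and $d_i$, $s_i$ acting componentwise. Alexander–Whitney map: $\Delta(\sigma\times\tau)=\sum_{i=0}^n d_{i+1}\cdots d_n\sigma\otimes(d_0)^i\tau$ for $\sigma\times\tau\in X_n\times Y_n$. Shuffle map: for $\sigma\in X_p$, $\tau\in Y_q$, $\nabla(\sigma\otimes\tau)=\sum_{(\mu,\nu)}\operatorname{sgn}(\mu,\nu)\,(s_{\nu_q}\cdots s_{\nu_1}\sigma)\times(s_{\mu_p}\cdots s_{\mu_1}\tau)$, summed over $(p,q)$-shuffles $(\mu,\nu)$, i.e. permutations $(\mu_1,\ldots,\mu_p,\nu_1,\ldots,\nu_q)$ of $(0,\ldots,p+q-1)$ with $\mu_1<\cdots<\mu_p$ and $\nu_1<\cdots<\nu_q$, where $\operatorname{sgn}$ is the sign of the permutation. A chain homotopy $P\colon\phi\simeq\psi$ satisfies $P\partial+\partial P=\psi-\phi$. The family is natural if $P_{X,Y}$ is functorial in $(X,Y)$ with respect to pairs of simplicial maps. The diameter of a chain $u=\sum n_\alpha e_\alpha$ in a based chain complex is $d(u)=\sum|n_\alpha|$; the diameter function of a chain homotopy $P\colon C_*\to D_{*+1}$ is $d_P(k)=\max\{d(P(c))\mid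 c\in C_i\text{ a basis element},\ i\le k\}$; a family $\{P_A\}$ is uniformly controlled by a function $\delta$ with values in $\mathbb Z_{\ge0}$ if $d_{P_A}(k)\le\delta(k)$ for all $A$ and $k$. *)

(* Defs.v *)
From mathcomp Require Import all_boot all_order all_fingroup all_algebra.
From mathcomp Require Import boolp.
From mathcomp Require Export freeg.

Set Implicit Arguments.
Unset Strict Implicit.
Unset Printing Implicit Defensive.

Import GRing.Theory.
Local Open Scope ring_scope.

(* Indices of [face] and [degen] are ordinals; the identities are stated for
   natural numbers in the admissible range, through [inord]. *)
Record sset := SSet {
  simplex :> nat -> Type;
  face : forall n, 'I_n.+2 -> simplex n.+1 -> simplex n;
  degen : forall n, 'I_n.+1 -> simplex n -> simplex n.+1;
  face_face : forall n (x : simplex n.+2) (i j : nat),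
    (i < j)%N -> (j <= n.+2)%N ->
    face (inord i) (face (inord j) x) = face (inord j.-1) (face (inord i) x);
  degen_degen : forall n (x : simplex n) (i j : nat),
    (i <= j)%N -> (j <= n)%N ->
    degen (inord i) (degen (inord j) x) =
    degen (inord j.+1) (degen (inord i) x);
  face_degen_lt : forall n (x : simplex n.+1) (i j : nat),
    (i < j)%N -> (j <= n.+1)%N ->
    face (inord i) (degen (inord j) x) = degen (inord j.-1) (face (inord i) x);
  face_degen_id : forall n (x : simplex n) (j : nat), (j <= n)%N ->
    face (inord j) (degen (inord j) x) = x;
  face_degen_idS : forall n (x : simplex n) (j : nat), (j <= n)%N ->
    face (inord j.+1) (degen (inord j) x) = x;
  face_degen_gt : forall n (x : simplex n.+1) (i j : nat),
    (j.+1 < i)%N -> (i <= n.+2)%N ->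
    face (inord i) (degen (inord j) x) = degen (inord j) (face (inord i.-1) x)
}.

Record smap (X Y : sset) := SMap {
  smap_fun :> forall n, X n -> Y n;
  smap_face : forall n (i : 'I_n.+2) (x : X n.+1),
    smap_fun (face i x) = face i (smap_fun x);
  smap_degen : forall n (i : 'I_n.+1) (x : X n),
    smap_fun (degen i x) = degen i (smap_fun x)
}.

Section Product.
Variables X Y : sset.

Definition prod_simplex (n : nat) : Type := (X n * Y n)%type.

Definition prod_face n (i : 'I_n.+2) (x : prod_simplex n.+1) :
  prod_simplex n := (face i x.1, face i x.2).

Definition prod_degen n (i : 'I_n.+1) (x : prod_simplex n) :
  prod_simplex n.+1 := (degen i x.1, degen i x.2).

Definition sprod : sset.
Proof.
exists prod_simplex prod_face prod_degen; rewrite /prod_face /prod_degen.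
- by move=> n x i j ij jn /=; rewrite !(face_face _ ij jn).
- by move=> n x i j ij jn /=; rewrite !(degen_degen _ ij jn).
- by move=> n x i j ij jn /=; rewrite !(face_degen_lt _ ij jn).
- by move=> n [x y] j jn /=; rewrite !face_degen_id.
- by move=> n [x y] j jn /=; rewrite !face_degen_idS.
- by move=> n x i j ij jn /=; rewrite !(face_degen_gt _ ij jn).
Defined.

End Product.

Definition sprod_map (X X' Y Y' : sset) (f : smap X X') (g : smap Y Y') :
  smap (sprod X Y) (sprod X' Y').
Proof.
exists (fun n (x : sprod X Y n) => (f n x.1, g n x.2) : sprod X' Y' n).
- by move=> n i x; rewrite /= /prod_face !smap_face.
- by move=> n i x; rewrite /= /prod_degen !smap_degen.
Defined.

(* The free abelian group on an arbitrary type: {classic T} is T endowed with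
   the (classical) choiceType structure required by {freeg _ / _}. *)
Definition freeab (T : Type) := {freeg {classic T} / int}.

Definition basis_elt (T : Type) (x : T) : freeab T := << (x : {classic T}) >>.

(* The homomorphism determined by its values on the basis. *)
Definition lin (T U : Type) (f : T -> freeab U) : freeab T -> freeab U :=
  fglift (f : {classic T} -> freeab U).

Definition diameter (T : Type) (u : freeab T) : nat :=
  (\sum_(x <- dom u) `|coeff x u|)%N.

Definition moore (X : sset) (n : nat) := freeab (X n).

Definition boundary (X : sset) (n : nat) : moore X n.+1 -> moore X n :=
  lin (fun x : X n.+1 => \sum_(i < n.+2) (-1) ^+ i *: basis_elt (face i x)).

Definition moore_map (X Y : sset) (f : smap X Y) (n : nat) :
  moore X n -> moore Y n :=
  lin (fun x : X n => basis_elt (f n x)).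

(* The tensor product of Z[A] and Z[B] is based by the tensors of a and b, with
   a and b in the given bases; [tcell A B n] is the basis in degree n. *)
Record tcell (A B : nat -> Type) (n : nat) := Tcell {
  ldeg : nat;
  rdeg : nat;
  tdegE : (ldeg + rdeg)%N = n;
  lcell : A ldeg;
  rcell : B rdeg
}.

Definition tensor (X Y : sset) (n : nat) := freeab (tcell X Y n).

Definition scast (X : sset) (m n : nat) (e : m = n) (x : X m) : X n :=
  ecast k (X k) e x.

(* front_face p q x = d_(p+1) ... d_(q+p) x *)
Fixpoint front_face (X : sset) (p q : nat) : X (q + p)%N -> X p :=
  if q is q'.+1 then fun x : X (q' + p).+1 => front_face (face ord_max x)
  else id.

(* back_face p q x = (d_0)^p x *)
Fixpoint back_face (X : sset) (p q : nat) : X (p + q)%N -> X q :=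
  if p is p'.+1 then fun x : X (p' + q).+1 => back_face (face ord0 x)
  else id.

(* degens f q x = s_(f (q-1)) ... s_(f 0) x *)
Fixpoint degens (X : sset) (f : nat -> nat) (q p : nat) (x : X p) :
  X (q + p)%N :=
  if q is q'.+1 then degen (inord (f q')) (degens f q' x) else x.

Definition AW_simplex (X Y : sset) (n : nat) (z : sprod X Y n) :
  tensor X Y n :=
  \sum_(i < n.+1)
    let e : (i + (n - i))%N = n := subnKC (leq_ord i) in
    let e' : (n - i + i)%N = n := subnK (leq_ord i) in
    basis_elt (Tcell e (front_face (scast (esym e') z.1))
                       (back_face (scast (esym e) z.2))).

Definition AW (X Y : sset) (n : nat) : moore (sprod X Y) n -> tensor X Y n :=
  lin (@AW_simplex X Y n).

(* With n = p + q, the permutation s of {0, ..., n-1} represents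
   (mu_1, ..., mu_p, nu_1, ..., nu_q) := (s 0, ..., s (n-1)). *)
Definition is_shuffle (p n : nat) (s : 'S_n) : bool :=
  [forall i : 'I_n, forall j : 'I_n,
    (i < j)%N && ((j < p)%N || (p <= i)%N) ==> (s i < s j)%N].

(* The value at i >= n is irrelevant. *)
Definition perm_nat (n : nat) (s : 'S_n) (i : nat) : nat :=
  oapp (fun j : 'I_n => nat_of_ord (s j)) 0%N (insub i).

Definition shuffle_cell (X Y : sset) (n : nat) (t : tcell X Y n) :
  moore (sprod X Y) n :=
  let: Tcell p q e x y := t in
  let mu (s : 'S_n) (i : nat) := perm_nat s i in
  let nu (s : 'S_n) (i : nat) := perm_nat s (p + i) in
  \sum_(s : 'S_n | is_shuffle p s)
    (-1) ^+ s *: basis_elt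
      ((scast (etrans (addnC q p) e) (degens (nu s) q x),
        scast e (degens (mu s) p y)) : sprod X Y n).

Definition shuffle (X Y : sset) (n : nat) :
  tensor X Y n -> moore (sprod X Y) n :=
  lin (@shuffle_cell X Y n).

(* P : phi ~ psi, that is P d + d P = psi - phi, where d = 0 on degree 0. *)
Definition chain_homotopy (X Y : sset) (phi psi : forall n, moore X n -> moore Y n)
    (P : forall n, {additive moore X n -> moore Y n.+1}) : Prop :=
  (forall u : moore X 0, boundary (P 0%N u) = psi 0%N u - phi 0%N u) /\
  (forall n (u : moore X n.+1),
     P n (boundary u) + boundary (P n.+1 u) = psi n.+1 u - phi n.+1 u).

(* d_P(k) <= m. The maximum defining d_P(k) is over a possibly empty or infinite
   set of values, hence it is compared with m through upper bounds. *)
Definition diameter_fun_le (X Y : sset)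
    (P : forall n, {additive moore X n -> moore Y n.+1}) (k m : nat) : Prop :=
  forall (i : nat) (c : X i), (i <= k)%N -> (diameter (P i (basis_elt c)) <= m)%N.

(* P X Y : Z(X x Y) -> Z(X x Y) of degree 1, for all simplicial sets X, Y. *)
Definition prod_family := forall (X Y : sset) (n : nat),
  {additive moore (sprod X Y) n -> moore (sprod X Y) n.+1}.

Definition natural_family (P : prod_family) : Prop :=
  forall (X X' Y Y' : sset) (f : smap X X') (g : smap Y Y') (n : nat)
         (u : moore (sprod X Y) n),
    moore_map (sprod_map f g) (P X Y n u) =
    P X' Y' n (moore_map (sprod_map f g) u).

Definition uniformly_controlled (P : prod_family) (delta : nat -> nat) : Prop :=
  forall (X Y : sset) (k : nat), diameter_fun_le (P X Y) k (delta k).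

(* Main.v *)
From HB Require Import structures.
From mathcomp Require Import all_boot all_order all_fingroup all_algebra.
From mathcomp Require Import boolp zify.
Require Import Defs.

(** The homotopy is the one of Eilenberg and Mac Lane, organised around the
    decalage [dec X] of a simplicial set: its n-simplices are the
    (n+1)-simplices of [X], its i-th face and degeneracy are those of index
    i+1 in [X].  Three facts about it drive every proof below.  The face d_0
    is a simplicial map from [dec X] to [X].  The simplices of
    [sprod (dec X) (dec Y)] are those of [sprod X Y], one dimension up.  The
    boundary is d_0 minus the boundary of the decalage ([boundaryE]).  So a
    natural family F of maps defined on all products has a derived family F',
    namely F on [dec X] and [dec Y], and naturality along d_0 gives
    d_0 F' = F d_0, hence boundary F' = F d_0 - (boundary F)'.

    Let g be the shuffle map after the Alexander-Whitney map, and let E send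
    (x, y) to the pair formed by the constant simplex at the initial vertex of
    x and by y.  Put
      R_n = g_n' s_0 - s_0 E_n,   P_0 = 0,   P_(n+1) = - P_n' - R_(n+1).
    If g is a natural chain map, then, with D for the boundary of the decalage,
    boundary R_(n+1) = R_n D + g_(n+1) - g_n' ([boundary_ez_cone]).  Feeding
    this into the recursion, and using that P' is, by induction, a homotopy
    from g' to the identity, all terms of P boundary + boundary P cancel
    except id - g ([ez_homotopyP]).

    The two terms of R_n share a summand.  Indeed g_n (x, y) is the sum over
    i of the shuffles of the front i-face of x with a back face of y; the term
    i = 0 is the single simplex E_n (x, y), and its derived version applied to
    s_0 (x, y) is s_0 E_n (x, y).  As there are binomial(n, i) shuffles in the
    term i, the diameter of R_n is at most 2^n - 1, and that of P_n at most
    the sum of 2^k - 1 for k from 1 to n, which is 2^(n+1) - n - 2: this gives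
    0, 1, 4, 11, 26.

    That g is a chain map is obtained from its two factors, again by recursion
    on the decalage.  A shuffle is a lattice path; removing its first step
    expresses the shuffle map of [X] and [Y] by that of [dec X] and [dec Y]
    ([shuffle_cell_first_step], [shuffle_boundary]).  Splitting off the term
    i = 0 expresses the Alexander-Whitney map of [X] and [Y] by that of
    [dec X] and [Y] ([AW_simplexS], [AW_boundary_simplex]). *)

Set Implicit Arguments.
Unset Strict Implicit.
Unset Printing Implicit Defensive.

Import GRing.Theory Num.Theory.
Local Open Scope ring_scope.
Local Notation lift := fintype.lift.

(** * Free abelian groups and diameters *)

Section Lin.
Variables T U : Type.

Lemma lin_is_zmod_morphism (f : T -> freeab U) : zmod_morphism (lin f).
Proof. exact: lift_is_additive. Qed.

HB.instance Definition _ (f : T -> freeab U) :=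
  GRing.isZmodMorphism.Build (freeab T) (freeab U) (lin f)
    (lin_is_zmod_morphism f).

Lemma lin_basis (f : T -> freeab U) x : lin f (basis_elt x) = f x.
Proof. by rewrite /lin /basis_elt liftU scale1r. Qed.

Lemma additive_ext (M : zmodType) (F G : {additive freeab T -> M}) :
  (forall x, F (basis_elt x) = G (basis_elt x)) -> F =1 G.
Proof.
move=> FG u; rewrite -[u]freeg_sumE !raddf_sum; apply: eq_bigr => x _.
by rewrite -[coeff x u]intz -freegU_mulz !raddfMz FG.
Qed.

End Lin.

Lemma lin_lin T U V (f : U -> freeab V) (h : T -> freeab U) u :
  lin f (lin h u) = lin (lin f \o h) u.
Proof. by apply: (additive_ext (F := lin f \o lin h)) => x; rewrite /= !lin_basis. Qed.

Lemma eq_lin T U (f h : T -> freeab U) u : f =1 h -> lin f u = lin h u.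
Proof. by move=> fh; apply: additive_ext => x; rewrite /= !lin_basis. Qed.

Definition push T U (h : T -> U) : freeab T -> freeab U :=
  lin (fun x => basis_elt (h x)).

HB.instance Definition _ T U (h : T -> U) :=
  GRing.Additive.copy (push h) (lin (fun x => basis_elt (h x))).

Section Push.
Variables T U V : Type.

Lemma push_basis (h : T -> U) x : push h (basis_elt x) = basis_elt (h x).
Proof. exact: lin_basis. Qed.

Lemma lin_push (f : U -> freeab V) (h : T -> U) u :
  lin f (push h u) = lin (f \o h) u.
Proof. by rewrite /push lin_lin; apply: eq_lin => x; rewrite /= lin_basis. Qed.

Lemma push_lin (f : U -> V) (h : T -> freeab U) u :
  push f (lin h u) = lin (push f \o h) u.
Proof. exact: lin_lin. Qed.

Lemma push_push (f : U -> V) (h : T -> U) u : push f (push h u) = push (f \o h) u.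
Proof. exact: lin_push. Qed.

Lemma lin_id (u : freeab T) : lin (@basis_elt T) u = u.
Proof. by apply: (additive_ext (G := idfun)) => x; rewrite /= lin_basis. Qed.

End Push.

Section LinAdditive.
Variables T U : Type.

Lemma lin_addf (f h : T -> freeab U) u :
  lin (fun x => f x + h x) u = lin f u + lin h u.
Proof. by apply: (additive_ext (G := lin f \+ lin h)) => x; rewrite /= !lin_basis. Qed.

Lemma lin_subf (f h : T -> freeab U) u :
  lin (fun x => f x - h x) u = lin f u - lin h u.
Proof. by apply: (additive_ext (G := lin f \- lin h)) => x; rewrite /= !lin_basis. Qed.

Lemma lin_oppf (f : T -> freeab U) u : lin (fun x => - f x) u = - lin f u.
Proof. by apply: (additive_ext (G := (\- (lin f)))) => x; rewrite /= !lin_basis. Qed.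

Lemma lin_signf k (f : T -> freeab U) u :
  lin (fun x => (-1) ^+ k *: f x) u = (-1) ^+ k *: lin f u.
Proof.
rewrite -signr_odd; case: (odd k).
  by rewrite scaleN1r -lin_oppf; apply: eq_lin => x; rewrite scaleN1r.
by rewrite scale1r; apply: eq_lin => x; rewrite scale1r.
Qed.

Lemma linD (f : T -> freeab U) u v : lin f (u + v) = lin f u + lin f v.
Proof. exact: raddfD. Qed.

Lemma linB (f : T -> freeab U) u v : lin f (u - v) = lin f u - lin f v.
Proof. exact: raddfB. Qed.

Lemma lin_sign k (f : T -> freeab U) u :
  lin f ((-1) ^+ k *: u) = (-1) ^+ k *: lin f u.
Proof. exact: raddfZsign. Qed.

Lemma lin0 (f : T -> freeab U) : lin f 0 = 0.
Proof. exact: raddf0. Qed.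

Lemma lin0f u : lin (fun _ : T => 0 : freeab U) u = 0.
Proof. by apply: (additive_ext (G := \0)) => x; rewrite /= lin_basis. Qed.

End LinAdditive.

Section Diameter.
Variable T : Type.
Implicit Types u v : freeab T.

(** Lets the diameters of [u], [v] and [u + v] be compared on one common list,
    although their supports differ. *)
Lemma sum_coeff_le_diameter (s : seq {classic T}) u : uniq s ->
  (\sum_(x <- s) `|coeff x u| <= diameter u)%N.
Proof.
move=> us; rewrite (bigID (mem (dom u))) /= [X in (_ + X)%N]big1 ?addn0; last first.
  by move=> x /coeff_outdom ->.
rewrite -big_filter; apply: (@uniq_sub_le_big _ addn leq leqnn (fun m n => leq_addr n m)).
- by rewrite filter_uniq.
- exact: uniq_dom.
- by move=> x; rewrite mem_filter => /andP[].
Qed.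

Lemma diameterD u v : (diameter (u + v)%R <= diameter u + diameter v)%N.
Proof.
apply: leq_trans (leq_add (sum_coeff_le_diameter u (uniq_dom (u + v)))
  (sum_coeff_le_diameter v (uniq_dom (u + v)))).
rewrite -big_split; apply: leq_sum => x _.
by rewrite coeffD -lez_nat PoszD !abszE ler_normD.
Qed.

Lemma diameterN u : diameter (- u) = diameter u.
Proof.
rewrite /diameter (perm_big _ (domN_perm_eq u)).
by apply: eq_bigr => x _; rewrite coeffN abszN.
Qed.

Lemma diameter0 : diameter (0 : freeab T) = 0%N.
Proof. by rewrite /diameter dom0 big_nil. Qed.

Lemma diameter_sign k u : diameter ((-1) ^+ k *: u) = diameter u.
Proof.
by rewrite -signr_odd; case: (odd k); rewrite ?scaleN1r ?diameterN ?scale1r.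
Qed.

Lemma diameter_basis (x : T) : diameter (basis_elt x) = 1%N.
Proof. by rewrite /diameter domU1 big_seq1 coeffU eqxx. Qed.

Lemma diameter_sum I r (P : pred I) (F : I -> freeab T) :
  (diameter (\sum_(i <- r | P i) F i)%R <= \sum_(i <- r | P i) diameter (F i))%N.
Proof.
elim/big_ind2: _ => [|u m v k um vk|//]; first by rewrite diameter0.
exact: leq_trans (diameterD u v) (leq_add um vk).
Qed.

End Diameter.

(** * Decalage *)

Lemma lift0_inord n i : (i <= n)%N ->
  lift ord0 (inord i : 'I_n.+1) = inord i.+1 :> 'I_n.+2.
Proof. by move=> i_n; apply: val_inj; rewrite /= /bump /= !inordK. Qed.

Lemma inord0 n : inord 0 = ord0 :> 'I_n.+1.
Proof. by apply: val_inj; rewrite /= inordK. Qed.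

Section Decalage.
Variable X : sset.

Definition dec_face n (i : 'I_n.+2) (x : X n.+2) : X n.+1 := face (lift ord0 i) x.
Definition dec_degen n (i : 'I_n.+1) (x : X n.+1) : X n.+2 := degen (lift ord0 i) x.

Definition dec : sset.
Proof.
exists (fun n => X n.+1) dec_face dec_degen; rewrite /dec_face /dec_degen.
- move=> n x i j ij jn; have j_gt0 : (0 < j)%N by lia.
  rewrite !lift0_inord; [|lia..].
  by rewrite face_face // prednK.
- by move=> n x i j ij jn; rewrite !lift0_inord; [rewrite degen_degen|lia..].
- move=> n x i j ij jn; have j_gt0 : (0 < j)%N by lia.
  by rewrite !lift0_inord; [rewrite face_degen_lt // prednK|lia..].
- by move=> n x j jn; rewrite !lift0_inord; [rewrite face_degen_id|lia..].
- by move=> n x j jn; rewrite !lift0_inord; [rewrite face_degen_idS|lia..].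
- move=> n x i j ji i_n; have i_gt0 : (0 < i)%N by lia.
  by rewrite !lift0_inord; [rewrite face_degen_gt // prednK|lia..].
Defined.

(** The identity d_0 d_(i+1) = d_i d_0 is exactly the compatibility of d_0 with
    the shifted faces. *)
Definition face0_map : smap dec X.
Proof.
exists (fun n (x : X n.+1) => face ord0 x) => n i x.
- rewrite /= /dec_face -[i in lift _ i]inord_val lift0_inord; last exact: leq_ord.
  by rewrite -!inord0 face_face // ?inord_val //= ltnS leq_ord.
- rewrite /= /dec_degen -[i in lift _ i]inord_val lift0_inord; last exact: leq_ord.
  by rewrite -!inord0 face_degen_lt // ?inord_val //= ltnS leq_ord.
Defined.

End Decalage.

Arguments dec : simpl never.

Definition dec_map (X Y : sset) (f : smap X Y) : smap (dec X) (dec Y).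
Proof.
exists (fun n (x : X n.+1) => f n.+1 x) => n i x.
- exact: (smap_face f (lift ord0 i)).
- exact: (smap_degen f (lift ord0 i)).
Defined.

Section Faces.
Variable X : sset.

Definition faces n (x : X n.+1) : moore X n :=
  \sum_(i < n.+2) (-1) ^+ i *: basis_elt (face i x).

(** This is [faces] on [dec X], by conversion, when [n > 0].  In degree 0 the
    decalage has no boundary, while the face d_1 of a 1-simplex is still needed:
    this definition covers both cases. *)
Definition pos_faces n (x : X n.+1) : moore X n :=
  \sum_(i < n.+1) (-1) ^+ i *: basis_elt (face (lift ord0 i) x).

Lemma facesE n (x : X n.+1) : faces x = basis_elt (face ord0 x) - pos_faces x.
Proof.
rewrite /faces big_ord_recl scale1r -sumrN; congr (_ + _).
by apply: eq_bigr => i _; rewrite /= exprS mulN1r scaleNr.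
Qed.

Lemma boundaryE n (u : moore X n.+1) :
  boundary u = push (face ord0) u - lin (@pos_faces n) u.
Proof. by rewrite /boundary -lin_subf; apply: eq_lin => x; rewrite -facesE. Qed.

Lemma face0_degen0 n (x : X n) : face ord0 (degen ord0 x) = x.
Proof. by rewrite -!inord0 face_degen_id. Qed.

Lemma face1_degen0 n (x : X n) : face (lift ord0 ord0) (degen ord0 x) = x.
Proof.
have -> : lift ord0 ord0 = inord 1 :> 'I_n.+2 by apply: val_inj; rewrite /= inordK.
by rewrite -(inord0 n) face_degen_idS.
Qed.

Lemma face_degen0 n (i : 'I_n.+1) (x : X n.+1) :
  face (lift ord0 (lift ord0 i)) (degen ord0 x) = degen ord0 (face (lift ord0 i) x).
Proof.
have i_n := ltn_ord i; rewrite -[lift ord0 i]inord_val lift0_inord //=.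
by rewrite -(inord0 n.+1) face_degen_gt // inord0.
Qed.

(** The cone formula: [degen ord0] is a contraction of the decalage, because
    d_1 s_0 is the identity and d_(i+2) s_0 = s_0 d_(i+1). *)
Lemma pos_faces_degen0 n (x : X n.+1) :
  pos_faces (degen ord0 x) = basis_elt x - push (degen ord0) (pos_faces x).
Proof.
rewrite /pos_faces big_ord_recl raddf_sum -sumrN; congr (_ + _).
  by rewrite scale1r face1_degen0.
apply: eq_bigr => i _; rewrite raddfZsign /= push_basis -scaleNr /= exprS mulN1r.
by rewrite face_degen0.
Qed.

(** The identity terms d_0 s_0 and d_1 s_0 cancel. *)
Lemma boundary_degen0 n (u : moore X n.+1) :
  boundary (push (degen ord0) u) = push (degen ord0) (lin (@pos_faces n) u).
Proof.
rewrite /boundary lin_push push_lin; apply: eq_lin => x /=.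
rewrite -/(faces _) facesE face0_degen0 pos_faces_degen0 opprD opprK addrA.
by rewrite subrr add0r.
Qed.

End Faces.

(** * The tensor product of two Moore complexes *)

Section Tens.
Variables (A B : nat -> Type) (p q n : nat) (e : (p + q)%N = n).

Definition tens (u : freeab (A p)) (v : freeab (B q)) : freeab (tcell A B n) :=
  lin (fun x => push (Tcell e x) v) u.

Lemma tens_basis x y : tens (basis_elt x) (basis_elt y) = basis_elt (Tcell e x y).
Proof. by rewrite /tens lin_basis push_basis. Qed.

Lemma tensBl u u' v : tens (u - u') v = tens u v - tens u' v.
Proof. exact: raddfB. Qed.

Lemma tensBr u v v' : tens u (v - v') = tens u v - tens u v'.
Proof. by rewrite /tens -lin_subf; apply: eq_lin => x; rewrite raddfB. Qed.

HB.instance Definition _ u := GRing.isZmodMorphism.Build _ _ (tens u) (tensBr u).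

Lemma tens_lin T (k : T -> freeab (B q)) u w :
  tens u (lin k w) = lin (fun y => tens u (k y)) w.
Proof. by apply: (additive_ext (F := tens u \o lin k)) => y; rewrite /= !lin_basis. Qed.

End Tens.

Lemma lin_tens (A B : nat -> Type) (T : Type) p q n (e : (p + q)%N = n)
    (F : tcell A B n -> freeab T) (u : freeab (A p)) (v : freeab (B q)) :
  lin F (tens e u v) = lin (fun x => lin (fun y => F (Tcell e x y)) v) u.
Proof. by rewrite lin_lin; apply: eq_lin => x /=; rewrite lin_push. Qed.

Section Lower.
Variables A A' B B' : nat -> Type.

(** The map f tensor h for f of degree -1; by convention f vanishes in
    degree 0.  Both halves of the boundary and of [first_step] have this form
    or that of [lower_right], so that they compose by the same rules. *)
Definition lower_left (f : forall p, A p.+1 -> freeab (A' p))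
    (h : forall q, B q -> B' q)
    n (t : tcell A B n.+1) : freeab (tcell A' B' n) :=
  let: Tcell p q e x y := t in
  match p return (p + q)%N = n.+1 -> A p -> freeab (tcell A' B' n) with
  | 0 => fun _ _ => 0
  | p'.+1 => fun e x => tens (succn_inj e) (f _ x) (basis_elt (h _ y))
  end e x.

(** The map f tensor h for h of degree -1, with the Koszul sign. *)
Definition lower_right (f : forall p, A p -> A' p)
    (h : forall q, B q.+1 -> freeab (B' q))
    n (t : tcell A B n.+1) : freeab (tcell A' B' n) :=
  let: Tcell p q e x y := t in
  match q return (p + q)%N = n.+1 -> B q -> freeab (tcell A' B' n) with
  | 0 => fun _ _ => 0
  | q'.+1 => fun e y => (-1) ^+ p *:
      tens (succn_inj (etrans (esym (addnS p q')) e)) (basis_elt (f _ x)) (h _ y)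
  end e y.

Lemma lower_leftS f h n p q (e : (p.+1 + q)%N = n.+1) (e' : (p + q)%N = n) x y :
  lower_left f h (Tcell e x y) = tens e' (f _ x) (basis_elt (h _ y)).
Proof. by rewrite /= (eq_irrelevance (succn_inj e) e'). Qed.

Lemma lower_rightS f h n p q (e : (p + q.+1)%N = n.+1) (e' : (p + q)%N = n) x y :
  lower_right f h (Tcell e x y) = (-1) ^+ p *: tens e' (basis_elt (f _ x)) (h _ y).
Proof. by rewrite /= (eq_irrelevance (succn_inj _) e'). Qed.

Lemma lower_left_tens f h n p q (e : (p.+1 + q)%N = n.+1) (e' : (p + q)%N = n) u v :
  lin (@lower_left f h n) (tens e u v) = tens e' (lin (f p) u) (push (h q) v).
Proof.
rewrite lin_tens [RHS]/tens lin_lin; apply: eq_lin => x.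
rewrite /= -[RHS]/(tens e' (f p x) _) tens_lin; apply: eq_lin => y.
by rewrite (eq_irrelevance (succn_inj e) e').
Qed.

Lemma lower_left_tens0 f h n q (e : (0 + q)%N = n.+1) u v :
  lin (@lower_left f h n) (tens e u v) = 0.
Proof. by rewrite lin_tens -[RHS](lin0f _ u); apply: eq_lin => x; apply: lin0f. Qed.

Lemma lower_right_tens f h n p q (e : (p + q.+1)%N = n.+1)
    (e' : (p + q)%N = n) u v :
  lin (@lower_right f h n) (tens e u v) = (-1) ^+ p *: tens e' (push (f p) u) (lin (h q) v).
Proof.
rewrite lin_tens -lin_signf.
rewrite lin_push; apply: eq_lin => x.
rewrite /= push_lin -lin_signf; apply: eq_lin => y.
by rewrite (eq_irrelevance (succn_inj _) e') /tens lin_basis.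
Qed.

Lemma lower_right_tens0 f h n p (e : (p + 0)%N = n.+1) u v :
  lin (@lower_right f h n) (tens e u v) = 0.
Proof. by rewrite lin_tens -[RHS](lin0f _ u); apply: eq_lin => x; apply: lin0f. Qed.

End Lower.

Section TensorMaps.
Variables X Y : sset.

Definition tboundary_left n (t : tcell X Y n.+1) : tensor X Y n :=
  lower_left (@faces X) (fun q (y : Y q) => y) t.

Definition tboundary_right n (t : tcell X Y n.+1) : tensor X Y n :=
  lower_right (fun p (x : X p) => x) (@faces Y) t.

Definition tboundary n (t : tcell X Y n.+1) : tensor X Y n :=
  tboundary_left t + tboundary_right t.

(** The tensor boundary with every d_0 removed. *)
Definition pos_tboundary n (t : tcell X Y n.+1) : tensor X Y n :=
  lower_left (@pos_faces X) (fun q (y : Y q) => y) t +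
  lower_right (fun p (x : X p) => x) (@pos_faces Y) t.

Definition first_step_left n (t : tcell X Y n.+1) : tensor (dec X) (dec Y) n :=
  lower_left (fun p (x : X p.+1) => basis_elt (x : dec X p))
       (fun q (y : Y q) => degen ord0 y : dec Y q) t.

Definition first_step_right n (t : tcell X Y n.+1) : tensor (dec X) (dec Y) n :=
  lower_right (fun p (x : X p) => degen ord0 x : dec X p)
       (fun q (y : Y q.+1) => basis_elt (y : dec Y q)) t.

(** A lattice path from (0, 0) to (p, q) starts in one of two directions.  If it
    starts along x, the pair of first edges is that of x and a degenerate edge
    of y, so what remains is a path for x, seen in [dec X], and s_0 y, seen in
    [dec Y]; if it starts along y, it has to be moved past the p steps along x,
    whence the sign carried by [lower_right]. *)
Definition first_step n
    (t : tcell X Y n.+1) := first_step_left t + first_step_right t.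

Definition tmap X' Y' (f : smap X X') (g : smap Y Y') n (t : tcell X Y n) :
  tcell X' Y' n :=
  let: Tcell p q e x y := t in Tcell e (f p x) (g q y).

End TensorMaps.

Section TensorBoundary.
Variables X Y : sset.

(** The analogue of [boundaryE]: the faces d_0 of x and y are recovered from
    [first_step], since d_0 s_0 is the identity. *)
Lemma tboundaryE n (t : tcell X Y n.+1) :
  tboundary t =
  push (@tmap _ _ X Y (face0_map X) (face0_map Y) n) (first_step t)
  - pos_tboundary t.
Proof.
case: t => p q e x y.
rewrite /tboundary /tboundary_left /tboundary_right /first_step /pos_tboundary.
rewrite raddfD /= opprD addrACA.
congr (_ + _).
- case: p e x => [|p] e x; first by rewrite /= raddf0 subr0.
  rewrite /= facesE tensBl; congr (_ - _).
  by rewrite /first_step_left /= !tens_basis push_basis /= face0_degen0.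
- case: q e y => [|q] e y; first by rewrite /= raddf0 subr0.
  rewrite /= facesE tensBr scalerBr; congr (_ - _).
  by rewrite /first_step_right /= !tens_basis raddfZsign /= push_basis /= face0_degen0.
Qed.

(** The terms that lower both p and q come from d_1 s_0 = id on either factor;
    they carry opposite signs and cancel, and the others match one by one. *)
Lemma first_step_tboundary n (t : tcell X Y n.+2) :
  lin (@first_step X Y n) (pos_tboundary t) = lin (@tboundary (dec X) (dec Y) n) (first_step t).
Proof.
case: t => p q e x y.
rewrite /pos_tboundary /first_step /tboundary !lin_addf !linD.
set T1 := lower_left _ _ _; set T2 := lower_right _ _ _.
set S1 := first_step_left _; set S2 := first_step_right _.
pose dl := @tboundary_left (dec X) (dec Y) n.
pose dr := @tboundary_right (dec X) (dec Y) n.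
suff [-> -> E] : [/\ lin (@first_step_left X Y n) T1 = lin dl S1,
    lin (@first_step_right X Y n) T2 = lin dr S2
  & lin (@first_step_left X Y n) T2 + lin (@first_step_right X Y n) T1 =
    lin dr S1 + lin dl S2].
  by rewrite -!addrA; congr (_ + _); rewrite addrA E -addrA addrCA.
rewrite {}/T1 {}/T2 {}/S1 {}/S2 {}/dl {}/dr; split.
- case: p e x => [|[|p]] e x; rewrite /first_step_left /tboundary_left /tboundary_right.
  + by rewrite /= !lin0.
  + by rewrite /= !lower_left_tens0.
  + have e' : (p + q)%N = n by lia.
    have e1 : (p.+1 + q)%N = n.+1 by lia.
    rewrite !(lower_leftS _ _ _ e1) !(lower_left_tens _ _ _ e').
    by rewrite !push_basis lin_basis lin_id.
- case: q e y => [|[|q]] e y; rewrite /first_step_right /tboundary_left /tboundary_right.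
  + by rewrite /= !lin0.
  + by rewrite /= !lin_sign !lower_right_tens0.
  + have e' : (p + q)%N = n by lia.
    have e1 : (p + q.+1)%N = n.+1 by lia.
    rewrite !(lower_rightS _ _ _ e1) !lin_sign !(lower_right_tens _ _ _ e').
    by rewrite !push_basis lin_basis lin_id.
- rewrite /first_step_left /first_step_right /tboundary_left /tboundary_right.
  case: p e x => [|p] e x; case: q e y => [|q] e y.
  + by lia.
  + by rewrite /= !lin0 !lin_sign !lower_left_tens0 !scaler0.
  + by rewrite /= !lin0 !lower_right_tens0.
  have e1 : (p.+1 + q)%N = n.+1 by lia.
  have e2 : (p + q.+1)%N = n.+1 by lia.
  have e' : (p + q)%N = n by lia.
  rewrite !(lower_rightS _ _ _ e1) !(lower_leftS _ _ _ e2) !lin_sign.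
  rewrite !(lower_right_tens _ _ _ e') !(lower_left_tens _ _ _ e').
  rewrite !push_basis !lin_basis.
  (* [faces] is taken in the decalage, where s_0 z has the dimension of z. *)
  have F (Z : sset) r (z : Z r.+1) : faces (degen ord0 z : dec Z r.+1) =
    basis_elt z - push (degen ord0) (pos_faces z) :> freeab (Z r.+1) := pos_faces_degen0 z.
  rewrite !F tensBl tensBr exprS mulN1r !scaleNr !scalerBr opprB.
  by rewrite [RHS]addrC addrA subrK addrC.
Qed.

End TensorBoundary.

(** * Recursion on shuffles *)

(** A permutation with a prescribed value at [i] is a permutation of the other
    places. *)
Lemma sum_lift_perm (V : nmodType) n (i j : 'I_n.+1) (F : 'S_n.+1 -> V) :
  \sum_(s : 'S_n.+1 | s i == j) F s = \sum_(s : 'S_n) F (lift_perm i j s).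
Proof.
have inj_lift : injective (lift_perm i j).
  move=> s t st; apply/permP => k.
  by apply: (@lift_inj _ j); rewrite -!(lift_perm_lift i) st.
rewrite (reindex (lift_perm i j)).
  by apply: eq_bigl => s; rewrite lift_perm_id eqxx.
apply: subon_bij (bij_on_codom inj_lift (1%g : 'S_n)) => s.
rewrite !inE => /eqP si.
have /fin_all_exists [f fE] k : exists k', s (lift i k) = lift j k'.
  have /unlift_some[k' -> _] : j != s (lift i k); last by exists k'.
  by rewrite -si (inj_eq perm_inj) neq_lift.
have inj_f : injective f.
  by move=> k l kl; apply: (@lift_inj _ i); apply: (@perm_inj _ s); rewrite !fE kl.
apply/codomP; exists (perm inj_f); apply/permP => k.
case: (unliftP i k) => [k'|] ->; last by rewrite lift_perm_id.
by rewrite lift_perm_lift permE fE.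
Qed.

Lemma is_shuffleP p n (s : 'S_n) :
  reflect (forall i j : 'I_n, (i < j)%N -> (j < p)%N || (p <= i)%N -> (s i < s j)%N)
          (is_shuffle p s).
Proof.
apply: (iffP forallP) => H i; last first.
  by apply/forallP => j; apply/implyP => /andP[]; apply: H.
by move=> j ij pij; apply: (implyP (forallP (H i) j)); rewrite ij.
Qed.

Lemma lift_perm_liftE n (i : 'I_n.+1) (s : 'S_n) k :
  lift_perm i ord0 s (lift i k) = (s k).+1 :> nat.
Proof. by rewrite lift_perm_lift. Qed.

Lemma is_shuffle_lift0 p n (s : 'S_n) :
  is_shuffle p.+1 (lift_perm ord0 ord0 s) = is_shuffle p s.
Proof.
apply/is_shuffleP/is_shuffleP => sh i j.
  by move=> ij pij; have := sh (lift ord0 i) (lift ord0 j); rewrite !lift_perm_liftE; apply.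
case: (unliftP ord0 j) => [j'|] -> //.
case: (unliftP ord0 i) => [i'|] ->; rewrite ?lift_perm_id lift_perm_liftE //.
by rewrite lift_perm_liftE; apply: sh.
Qed.

Lemma is_shuffle_liftp n (p : 'I_n.+1) (s : 'S_n) :
  is_shuffle p (lift_perm p ord0 s) = is_shuffle p s.
Proof.
apply/is_shuffleP/is_shuffleP => sh i j.
  move=> ij pij; have := sh (lift p i) (lift p j); rewrite !lift_perm_liftE; apply.
    by rewrite /= /bump; lia.
  by rewrite /= /bump; lia.
case: (unliftP p j) => [j'|] ->; last by lia.
case: (unliftP p i) => [i'|] ->; rewrite ?lift_perm_id lift_perm_liftE //.
rewrite lift_perm_liftE /= /bump => ij pij; apply: sh; lia.
Qed.

(** The value 0 of a (p, q)-shuffle is the least value of its block, hence it is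
    taken either at 0 or at the place [p] where the second block starts. *)
Lemma sum_shuffle (V : nmodType) n p (F : 'S_n.+1 -> V) :
  \sum_(s : 'S_n.+1 | is_shuffle p s) F s =
  (if p is p'.+1 then \sum_(s : 'S_n | is_shuffle p' s) F (lift_perm ord0 ord0 s) else 0) +
  (if (p <= n)%N then \sum_(s : 'S_n | is_shuffle p s) F (lift_perm (inord p) ord0 s) else 0).
Proof.
rewrite (bigID (fun s : 'S_n.+1 => (s^-1%g ord0 < p)%N)) /=; congr (_ + _).
- case: p => [|p]; first by rewrite big_pred0 // => s; rewrite ltn0 andbF.
  under eq_bigl => s.
    rewrite andbC (_ : _ && _ = (s ord0 == ord0) && is_shuffle p.+1 s); first over.
    apply/andP/andP => -[s0 sh]; split=> //; last first.
      by rewrite -(eqP s0) permK.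
    apply: contraLR sh => sn0; apply/is_shuffleP => /(_ ord0 (s^-1%g ord0)).
    rewrite permKV s0 => H; have k_gt0 : (0 < s^-1%g ord0)%N.
      rewrite lt0n; apply: contraNneq sn0 => k0; apply/eqP.
      by rewrite -[RHS](permKV s); congr (s _); apply: val_inj.
    by have := H k_gt0 isT.
  rewrite big_mkcondr sum_lift_perm [RHS]big_mkcond; apply: eq_bigr => s _.
  by rewrite is_shuffle_lift0.
- case: leqP => pn; last first.
    by rewrite big_pred0 // => s; rewrite (leq_trans (ltn_ord _) pn) andbF.
  have pE : (inord p : 'I_n.+1) = p :> nat by rewrite inordK.
  under eq_bigl => s.
    rewrite andbC (_ : _ && _ = (s (inord p) == ord0) && is_shuffle p s); first over.
    apply/andP/andP => -[s0 sh]; split=> //; last first.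
      by rewrite -(eqP s0) permK pE ltnn.
    apply: contraLR sh => sp; apply/is_shuffleP => /(_ (inord p) (s^-1%g ord0)).
    rewrite permKV pE leqnn orbT => H; have k_gtp : (p < s^-1%g ord0)%N.
      move: s0; rewrite -leqNgt leq_eqVlt => /orP[/eqP s0|//].
      by case/eqP: sp; rewrite s0 inord_val permKV.
    by have := H k_gtp isT.
  rewrite big_mkcondr sum_lift_perm [RHS]big_mkcond; apply: eq_bigr => s _.
  by have := is_shuffle_liftp (inord p) s; rewrite pE => ->.
Qed.

Lemma perm_natE n (s : 'S_n) (i : 'I_n) : perm_nat s i = s i.
Proof. by rewrite /perm_nat valK. Qed.

Lemma perm_nat_id n (p : 'I_n.+1) (s : 'S_n) :
  perm_nat (lift_perm p ord0 s) p = 0%N.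
Proof. by rewrite perm_natE lift_perm_id. Qed.

Lemma perm_nat_lift n (p : 'I_n.+1) (s : 'S_n) i : (i < n)%N ->
  perm_nat (lift_perm p ord0 s) (bump p i) = (perm_nat s i).+1.
Proof.
move=> i_n; rewrite -[i]/(val (Ordinal i_n)).
by rewrite -[bump _ _]/(val (lift p _)) !perm_natE lift_perm_liftE.
Qed.

Lemma increasing_bound (f : nat -> nat) m N :
    (forall i, (i.+1 < m)%N -> (f i < f i.+1)%N) ->
    (forall i, (i < m)%N -> (f i < N)%N) ->
  forall i, (i < m)%N -> (f i + (m - i) <= N)%N.
Proof.
move=> f_incr f_lt i im; have [k ik] : exists k, (i + k).+1 = m by exists (m - i.+1)%N; lia.
elim: k i im ik => [|k IHk] i im ik; first by have := f_lt i im; lia.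
have := f_incr i; have := IHk i.+1; lia.
Qed.

Lemma shuffle_perm_nat n p (s : 'S_n) i j : is_shuffle p s ->
  (i < j < n)%N -> (j < p)%N || (p <= i)%N -> (perm_nat s i < perm_nat s j)%N.
Proof.
move=> /is_shuffleP sh /andP[ij jn]; have i_n := ltn_trans ij jn.
rewrite -[i]/(val (Ordinal i_n)) -[j]/(val (Ordinal jn)) !perm_natE; exact: sh.
Qed.

Lemma perm_nat_lt n (s : 'S_n) i : (i < n)%N -> (perm_nat s i < n)%N.
Proof. by move=> i_n; rewrite -[i]/(val (Ordinal i_n)) perm_natE. Qed.

(** Together with [nu_bound], this keeps the degeneracy indices of a shuffle in
    the admissible range, where [inord] is faithful. *)
Lemma mu_bound n p q (s : 'S_n) i : (p + q)%N = n -> is_shuffle p s -> (i < p)%N ->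
  (perm_nat s i <= q + i)%N.
Proof.
move=> e sh ip; suff : (perm_nat s i + (p - i) <= n)%N by lia.
apply: increasing_bound ip => j jp; last by apply: perm_nat_lt; lia.
by apply: (shuffle_perm_nat sh); lia.
Qed.

Lemma nu_bound n p q (s : 'S_n) i : (p + q)%N = n -> is_shuffle p s -> (i < q)%N ->
  (perm_nat s (p + i) <= p + i)%N.
Proof.
move=> e sh iq; suff : (perm_nat s (p + i) + (q - i) <= n)%N by lia.
apply: (increasing_bound (f := fun i => perm_nat s (p + i))) iq => j jp.
  by apply: (shuffle_perm_nat sh); lia.
by apply: perm_nat_lt; lia.
Qed.

Lemma scast_id (X : sset) n (e : n = n) (x : X n) : scast e x = x.
Proof. by rewrite (eq_axiomK e). Qed.

Lemma scast_degen (X : sset) m n (e : m = n) (e' : m.+1 = n.+1) k (x : X m) :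
  scast e' (degen (inord k) x) = degen (inord k) (scast e x).
Proof. by case: n / e e' => e'; rewrite !scast_id. Qed.

Section Degens.
Variable X : sset.

Lemma scast_dec m n (e : m = n) (e' : m.+1 = n.+1) (x : X m.+1) :
  scast e' x = @scast (dec X) m n e x.
Proof. by case: n / e e' => e'; rewrite scast_id. Qed.

(** The fixpoint [degens] peels off the outermost degeneracy; the recursion on
    the decalage needs the innermost one. *)
Lemma degens_recl f q p n (e : (q.+1 + p)%N = n) (e' : (q + p.+1)%N = n) (x : X p) :
  scast e (degens f q.+1 x) =
  scast e' (degens (f \o succn) q (degen (inord (f 0%N)) x)).
Proof.
elim: q n e e' => [|q IHq] n e e'; first by rewrite (eq_irrelevance e e').
case: n e e' => [//|n] e e'.
rewrite [LHS](scast_degen (succn_inj e)) [RHS](scast_degen (succn_inj e')).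
by congr (degen _ _); apply: IHq.
Qed.

(** The range condition on [g] is needed because [inord] sends an index that is
    too large to 0, both here and in the decalage. *)
Lemma degens_dec f g q p n (e : (q + p.+1)%N = n.+1) (e' : (q + p)%N = n)
    (x : X p.+1) :
    (forall i, (i < q)%N -> f i = (g i).+1) ->
    (forall i, (i < q)%N -> (g i <= p + i)%N) ->
  scast e (degens f q x) = @scast (dec X) _ _ e' (@degens (dec X) g q p x).
Proof.
elim: q n e e' => [|q IHq] n e e' fg gp; first exact: scast_dec.
case: n e e' => [//|n] e e'.
rewrite [LHS](scast_degen (succn_inj e)) [RHS](@scast_degen (dec X) _ _ (succn_inj e')).
rewrite [RHS]/= /dec_degen lift0_inord; last by have := gp q (ltnSn q); lia.
by rewrite fg //; congr (degen _ _); apply: IHq => i iq; [apply: fg|apply: gp]; apply: leqW.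
Qed.

End Degens.

(** * The shuffle map *)

Section FirstStep.
Variables X Y : sset.

(** With [sum_shuffle], the permutations sending 0 to 0 give the paths that
    start along x, and those sending p to 0 the paths that start along y; the
    signs come from [odd_lift_perm]. *)
Lemma shuffle_cell_first_step n (t : tcell X Y n.+1) :
  shuffle_cell t = lin (@shuffle_cell (dec X) (dec Y) n) (first_step t)
    :> moore (sprod X Y) n.+1.
Proof.
case: t => p q e x y; rewrite /= sum_shuffle /first_step linD; congr (_ + _).
- case: p e x => [|p] e x; first by rewrite /first_step_left /= lin0.
  have e' : (p + q)%N = n by lia.
  rewrite /first_step_left (lower_leftS _ _ _ e') tens_basis lin_basis.
  apply: eq_bigr => s sh; rewrite odd_lift_perm; congr (_ *: basis_elt (_, _)).
    apply: degens_dec => i iq; last exact: nu_bound e' sh iq.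
    by rewrite -(@perm_nat_lift _ ord0) //; lia.
  have e1 : (p + q.+1)%N = n.+1 by lia.
  rewrite (degens_recl _ _ e1) (perm_nat_id ord0) inord0.
  apply: degens_dec => i ip; last exact: mu_bound e' sh ip.
  by rewrite /= -(@perm_nat_lift _ ord0) //; lia.
- case: q e y => [|q] e y.
    by rewrite /first_step_right /= lin0 ifN // -ltnNge -e addn0.
  have e' : (p + q)%N = n by lia.
  have pn : (p <= n)%N by lia.
  have pE : (inord p : 'I_n.+1) = p :> nat by rewrite inordK.
  rewrite pn /first_step_right (lower_rightS _ _ _ e') tens_basis lin_sign.
  rewrite lin_basis scaler_sumr; apply: eq_bigr => s sh.
  rewrite odd_lift_perm pE addbF signr_addb signr_odd scalerA.
  congr (_ *: basis_elt (_, _)).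
    have e1 : (q + p.+1)%N = n.+1 by lia.
    have s0 : perm_nat (lift_perm (inord p) ord0 s) p = 0%N.
      by rewrite -[X in perm_nat _ X]pE perm_nat_id.
    rewrite (degens_recl _ _ e1) /= addn0 s0 inord0.
    apply: degens_dec => i iq; last exact: nu_bound e' sh iq.
    rewrite /= -(@perm_nat_lift _ (inord p)) ?pE; last by lia.
    by congr perm_nat; rewrite /bump; lia.
  apply: degens_dec => i ip; last exact: mu_bound e' sh ip.
  rewrite -(@perm_nat_lift _ (inord p)) ?pE; last by lia.
  by congr perm_nat; rewrite /bump; lia.
Qed.

Lemma shuffle_cell0 (e : (0 + 0)%N = 0%N) (x : X 0) (y : Y 0) :
  shuffle_cell (Tcell e x y) = basis_elt ((x, y) : sprod X Y 0).
Proof.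
rewrite /= (big_pred1 (1%g : 'S_0)) => [|s].
  by rewrite odd_perm1 scale1r !scast_id.
rewrite /= (_ : s = 1%g) ?eqxx; last by apply/permP => -[].
by apply/is_shuffleP => -[].
Qed.

Lemma shuffle_first_step n (u : tensor X Y n.+1) :
  shuffle u = shuffle (lin (@first_step X Y n) u) :> moore (sprod X Y) n.+1.
Proof. by rewrite /shuffle lin_lin; apply: eq_lin => t; apply: shuffle_cell_first_step. Qed.

End FirstStep.

Section SmapDegens.
Variables (X X' : sset) (f : smap X X').

Lemma smap_scast m n (e : m = n) (x : X m) : f n (scast e x) = scast e (f m x).
Proof. by case: n / e. Qed.

Lemma smap_degens h q p (x : X p) : f (q + p)%N (degens h q x) = degens h q (f p x).
Proof. by elim: q => //= q IHq; rewrite smap_degen IHq. Qed.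

End SmapDegens.

Lemma shuffle_natural (X Y X' Y' : sset) (f : smap X X') (g : smap Y Y') n
    (u : tensor X Y n) :
  moore_map (sprod_map f g) (shuffle u) = shuffle (push (@tmap _ _ _ _ f g n) u).
Proof.
rewrite /moore_map /shuffle lin_lin lin_push; apply: eq_lin => -[p q e x y] /=.
rewrite raddf_sum; apply: eq_bigr => s _.
by rewrite raddfZsign /= lin_basis /= !smap_scast !smap_degens.
Qed.

Lemma shuffleB (X Y : sset) n (u v : tensor X Y n) :
  shuffle (u - v) = shuffle u - shuffle v.
Proof. exact: raddfB. Qed.

(** By [shuffle_first_step], d_0 of the left-hand side is computed by naturality,
    and its other faces form a boundary in the decalage, known by induction
    and rewritten by [first_step_tboundary]. *)
Lemma shuffle_boundary (X Y : sset) n (u : tensor X Y n.+1) :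
  boundary (shuffle u) = shuffle (lin (@tboundary X Y n) u).
Proof.
elim: n X Y u => [|n IHn] X Y u; rewrite boundaryE.
all: pose d0 k := @tmap _ _ _ _ (face0_map X) (face0_map Y) k.
all: have -> : push (face ord0) (shuffle u) =
    shuffle (push (@d0 _) (lin (@first_step X Y _) u)) :> moore (sprod X Y) _
  by rewrite shuffle_first_step -shuffle_natural.
all: have -> : lin (@tboundary X Y _) u =
    push (@d0 _) (lin (@first_step X Y _) u) - lin (@pos_tboundary X Y _) u
  by rewrite push_lin -lin_subf; apply: eq_lin => t; rewrite tboundaryE.
all: rewrite shuffleB; congr (_ - _).
- rewrite /shuffle !lin_lin; apply: eq_lin => -[p q e x y].
  have pos_faces1 (Z : sset) (z : Z 1) : pos_faces z = basis_elt (face (lift ord0 ord0) z).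
    by rewrite /pos_faces big_ord1 scale1r.
  rewrite /comp shuffle_cell_first_step /first_step /pos_tboundary !linD.
  case: p e x => [|[|p]] e x; case: q e y => [|[|q]] e y //.
  - rewrite /first_step_left /first_step_right /= !lin0 !add0r !lin_sign.
    rewrite !pos_faces1 !tens_basis !lin_basis.
    by rewrite !shuffle_cell0 lin_basis pos_faces1 /= /prod_face face1_degen0.
  - rewrite /first_step_left /first_step_right /= !lin0 !addr0.
    rewrite !pos_faces1 !tens_basis !lin_basis.
    by rewrite !shuffle_cell0 lin_basis pos_faces1 /= /prod_face face1_degen0.
- (* In degree n+1 > 0 the faces other than d_0 are the boundary of the
     decalage. *)
  rewrite shuffle_first_step [RHS]shuffle_first_step.
  rewrite -[LHS]/(@boundary (sprod (dec X) (dec Y)) _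
    (shuffle (lin (@first_step X Y _) u))) IHn !lin_lin.
  apply: (congr1 (@shuffle (dec X) (dec Y) n)); apply: eq_lin => t.
  by rewrite /comp first_step_tboundary.
Qed.

(** Under [first_step], the count of shuffles obeys the rule of Pascal. *)
Lemma diameter_shuffle_cell (X Y : sset) n p q (e : (p + q)%N = n) (x : X p)
    (y : Y q) :
  (diameter (shuffle_cell (Tcell e x y)) <= 'C(n, p))%N.
Proof.
elim: n X Y p q e x y => [|n IHn] X Y p q e x y.
  case: p q e x y => [|//] [|//] e x y.
  by rewrite shuffle_cell0 diameter_basis bin0.
rewrite shuffle_cell_first_step /first_step linD (leq_trans (diameterD _ _)) //.
case: p e x => [|p] e x; case: q e y => [|q] e y //.
- rewrite /first_step_left /= lin0 diameter0 add0n bin0 /first_step_right /=.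
  rewrite tens_basis lin_sign diameter_sign lin_basis.
  by have := IHn (dec X) (dec Y) 0%N q _ (degen ord0 x) y; rewrite bin0; apply.
- rewrite /first_step_right /= lin0 diameter0 addn0 /first_step_left /=.
  rewrite tens_basis lin_basis binS (leq_trans _ (leq_addl _ _)) //; apply: (IHn (dec X) (dec Y)).
- rewrite binS addnC /first_step_left /first_step_right leq_add //=.
    rewrite tens_basis lin_sign diameter_sign lin_basis.
    exact: (IHn (dec X) (dec Y)).
  by rewrite tens_basis lin_basis; apply: (IHn (dec X) (dec Y)).
Qed.

(** * The Alexander-Whitney map *)

Lemma lift0_max n : lift ord0 ord_max = ord_max :> 'I_n.+2.
Proof. exact: val_inj. Qed.

Lemma face0_face (X : sset) n (i : 'I_n.+2) (x : X n.+2) :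
  face ord0 (face (lift ord0 i) x) = face i (face ord0 x).
Proof. exact: (smap_face (face0_map X) i x). Qed.

Lemma scast_face0 (X : sset) m n (e : m.+1 = n.+1) (e' : m = n) (x : X m.+1) :
  face ord0 (scast e x) = scast e' (face ord0 x).
Proof. by case: n / e' e => e; rewrite !scast_id. Qed.

Lemma scast_face_max (X : sset) m n (e : m.+1 = n.+1) (e' : m = n) (x : X m.+1) :
  face ord_max (scast e x) = scast e' (face ord_max x).
Proof. by case: n / e' e => e; rewrite !scast_id. Qed.

Fixpoint vertex0 (X : sset) (n : nat) : X n -> X 0%N :=
  if n is n'.+1 then fun x => vertex0 (face ord_max x) else id.

Lemma vertex0S (X : sset) n (x : X n.+1) : vertex0 x = vertex0 (face ord_max x).
Proof. by []. Qed.

Section Vertex.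
Variable X : sset.

(** The initial vertex survives every face except d_0. *)
Lemma vertex0_face n (i : 'I_n.+1) (x : X n.+1) :
  vertex0 (face (lift ord0 i) x) = vertex0 x.
Proof.
elim: n i x => [|n IHn] i x.
  by rewrite [i]ord1 /= (_ : lift _ _ = ord_max) //; apply: val_inj.
have [i_n|n_i] := ltnP i n.+1; last first.
  rewrite (_ : i = ord_max) ?lift0_max //; apply: val_inj => /=.
  by apply/eqP; rewrite eqn_leq leq_ord.
rewrite vertex0S [RHS]vertex0S -(IHn (Ordinal i_n) (face ord_max x)); congr (vertex0 _).
have inordE m (k : 'I_m.+1) j : k = j :> nat -> k = inord j by move=> <-; rewrite inord_val.
rewrite (inordE _ (lift ord0 i) i.+1) // (inordE _ (lift ord0 (Ordinal i_n)) i.+1) //.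
rewrite (inordE _ (ord_max : 'I_n.+3) n.+2) // (inordE _ (ord_max : 'I_n.+2) n.+1) //.
by symmetry; apply: (face_face x).
Qed.

End Vertex.

(** The initial vertex of a simplex of [dec X] is the initial edge of the same
    simplex in [X]. *)
Lemma vertex0_dec (X : sset) n (x : X n.+1) :
  face (lift ord0 ord0) (vertex0 (x : dec X n)) = vertex0 x.
Proof.
elim: n x => [|n IHn] x.
  by rewrite /= (_ : lift _ _ = ord_max) //; apply: val_inj.
by rewrite [X in face _ X]vertex0S IHn [RHS]vertex0S /= /dec_face lift0_max.
Qed.

Lemma vertex0_degen0 (X : sset) n (x : X n) :
  vertex0 (degen ord0 x : dec X n) = degen ord0 (vertex0 x).
Proof.
elim: n x => [//|n IHn] x; rewrite [in RHS]vertex0S -IHn [LHS]vertex0S.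
congr (@vertex0 (dec X) n _).
rewrite -[LHS]/(face (lift ord0 ord_max) (degen ord0 x)).
rewrite lift0_max -(inord_val ord_max) -(inord0 n.+1) face_degen_gt //=.
by rewrite inord0 (_ : inord n.+1 = ord_max) //; apply: val_inj; rewrite /= inordK.
Qed.

Section FrontBack.
Variable X : sset.

Lemma front_face0 q n (e : n = (q + 0)%N) (x : X n) :
  front_face (scast e x) = vertex0 x.
Proof.
elim: q n e x => [|q IHq] n e x; first by case: n e x => // e x; rewrite scast_id.
case: n e x => // n e x.
by rewrite /= (scast_face_max e (succn_inj e)) IHq.
Qed.

Lemma front_face_dec p q n (e : n.+1 = (q + p.+1)%N) (e' : n = (q + p)%N)
    (x : X n.+1) :
  front_face (scast e x) = front_face (@scast (dec X) _ _ e' x) :> X p.+1.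
Proof.
elim: q n e e' x => [|q IHq] n e e' x; first exact: scast_dec.
case: n e e' x => // n e e' x.
rewrite [LHS]/= (scast_face_max e (succn_inj e)) (IHq _ _ (succn_inj e')).
have -> : face ord_max x = @face (dec X) n ord_max x by rewrite -lift0_max.
by rewrite -(scast_face_max e').
Qed.

Lemma back_faceS p q n (e : n.+1 = (p.+1 + q)%N) (e' : n = (p + q)%N) (x : X n.+1) :
  back_face (scast e x) = back_face (scast e' (face ord0 x)).
Proof. by rewrite /= (scast_face0 e e'). Qed.

End FrontBack.

(** Its image is spanned by the cells whose left degree is positive. *)
Definition undec_left (X Y : sset) n (t : tcell (dec X) Y n) : tcell X Y n.+1 :=
  let: Tcell p q e x y := t in
  Tcell (congr1 succn e : (p.+1 + q)%N = n.+1) (x : X p.+1) y.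

Lemma Tcell_eq (A B : nat -> Type) p q n (e e' : (p + q)%N = n) (x x' : A p)
    (y y' : B q) :
  x = x' -> y = y' -> Tcell e x y = Tcell e' x' y'.
Proof. by move=> -> ->; rewrite (eq_irrelevance e e'). Qed.

Lemma AW_term0 (X Y : sset) q n (e : (0 + q)%N = n) (e' : (q + 0)%N = n)
    (x : X n) (y : Y n) :
  Tcell e (front_face (scast (esym e') x)) (back_face (scast (esym e) y)) =
  Tcell (add0n n) (vertex0 x) y.
Proof.
rewrite front_face0; case: n / e e' x y => e' x y.
by apply: Tcell_eq; rewrite //= scast_id.
Qed.

(** For i > 0, the front i-face in [X] is the front (i-1)-face in [dec X], and
    the i-th power of d_0 on y is its (i-1)-th power on d_0 y. *)
Lemma AW_simplexS (X Y : sset) n (z : sprod X Y n.+1) :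
  AW_simplex z = basis_elt (Tcell (add0n n.+1) (vertex0 z.1) z.2)
    + push (@undec_left X Y n) (AW_simplex ((z.1, face ord0 z.2) : sprod (dec X) Y n)).
Proof.
rewrite /AW_simplex big_ord_recl; congr (_ + _).
  by congr basis_elt; apply: AW_term0.
rewrite raddf_sum; apply: eq_bigr => i _ /=; rewrite push_basis; congr basis_elt.
apply: Tcell_eq.
  exact: front_face_dec.
exact: back_faceS.
Qed.

Lemma AW_simplex0 (X Y : sset) (z : sprod X Y 0) :
  AW_simplex z = basis_elt (Tcell (add0n 0) z.1 z.2).
Proof. by rewrite /AW_simplex big_ord1; congr basis_elt; apply: AW_term0. Qed.

Lemma smap_front_face (X Y : sset) (f : smap X Y) p q (x : X (q + p)%N) :
  f p (front_face x) = front_face (f _ x).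
Proof. by elim: q x => //= q IHq x; rewrite IHq smap_face. Qed.

Lemma smap_back_face (X Y : sset) (f : smap X Y) p q (x : X (p + q)%N) :
  f q (back_face x) = back_face (f _ x).
Proof. by elim: p x => //= p IHp x; rewrite IHp smap_face. Qed.

Lemma AW_simplex_natural (X Y X' Y' : sset) (f : smap X X') (g : smap Y Y') n
    (z : sprod X Y n) :
  push (@tmap _ _ _ _ f g n) (AW_simplex z) = AW_simplex (sprod_map f g n z).
Proof.
rewrite /AW_simplex raddf_sum; apply: eq_bigr => i _ /=.
by rewrite push_basis /= smap_front_face smap_back_face !smap_scast.
Qed.

Definition id_map (X : sset) : smap X X :=
  @SMap X X (fun n x => x) (fun _ _ _ => erefl) (fun _ _ _ => erefl).

(** The terms d_1 x tensor y, for x of dimension 1, of the boundary of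
    [undec_left]: the boundary of [dec X] does not see them, because such an x
    has dimension 0 there. *)
Definition edge_source (X Y : sset) n (t : tcell (dec X) Y n) : tensor X Y n :=
  let: Tcell p q e x y := t in
  match p return (p + q)%N = n -> dec X p -> tensor X Y n with
  | 0 => fun e x => basis_elt (Tcell e (face (lift ord0 ord0) x : X 0) y)
  | p'.+1 => fun _ _ => 0
  end e x.

Lemma push_undec_left_tens (X Y : sset) n p q (e : (p + q)%N = n)
    (e' : (p.+1 + q)%N = n.+1) u v :
  push (@undec_left X Y n) (tens e u v) = tens e' (u : moore X p.+1) v.
Proof.
rewrite [LHS]lin_tens; apply: eq_lin => x; apply: eq_lin => y /=.
by congr basis_elt; apply: Tcell_eq.
Qed.

Lemma tboundary_undec_left0 (X Y : sset) (t : tcell (dec X) Y 0) :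
  tboundary (undec_left t) =
  push (@tmap _ _ _ _ (face0_map X) (id_map Y) 0) (basis_elt t) - edge_source t.
Proof.
case: t => -[|//] [|//] e x y.
rewrite /tboundary /tboundary_left /tboundary_right /= addr0 facesE tensBl.
rewrite push_basis /pos_faces big_ord1 scale1r.
by rewrite !tens_basis /=; congr (basis_elt _ - basis_elt _); apply: Tcell_eq.
Qed.

Lemma tboundary_undec_left (X Y : sset) n (t : tcell (dec X) Y n.+1) :
  tboundary (undec_left t) =
  push (@tmap _ _ _ _ (face0_map X) (id_map Y) n.+1) (basis_elt t)
  - edge_source t - push (@undec_left X Y n) (tboundary t).
Proof.
case: t => p q e x y; rewrite push_basis /tboundary raddfD opprD addrA.
congr (_ + _).
- rewrite /tboundary_left [LHS]/= facesE tensBl tens_basis -addrA; congr (_ + _).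
    by congr basis_elt; apply: Tcell_eq.
  case: p e x => [|p] e x.
    rewrite /= raddf0 subr0 /pos_faces big_ord1 scale1r tens_basis.
    congr (- basis_elt _); exact: Tcell_eq.
  rewrite /= oppr0 add0r; congr (- _); symmetry; exact: push_undec_left_tens.
- rewrite /tboundary_right; case: q e y => [|q] e y; first by rewrite /= raddf0 oppr0.
  rewrite /= raddfZsign exprS mulN1r scaleNr; congr (- (_ *: _)); symmetry.
  exact: push_undec_left_tens.
Qed.

(** The boundary of [dec X] and [Y] is absent from degree 0. *)
Definition undec_left_tboundary (X Y : sset) n :
  tensor (dec X) Y n -> tensor X Y n :=
  if n is n'.+1 then
    fun u => push (@undec_left X Y n') (lin (@tboundary (dec X) Y n') u)
  else fun _ => 0.

(** For x of dimension p in [dec X], that is p+1 in [X], the Koszul sign of the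
    second factor changes, and the faces of x other than d_0 also get a sign:
    [undec_left] anticommutes with the boundaries, up to d_0 and the edges. *)
Lemma lin_tboundary_undec_left (X Y : sset) n (u : tensor (dec X) Y n) :
  lin (@tboundary X Y n) (push (@undec_left X Y n) u) =
  push (@tmap _ _ _ _ (face0_map X) (id_map Y) n) u
  - lin (@edge_source X Y n) u - undec_left_tboundary u.
Proof.
rewrite lin_push; case: n u => [|n] u.
  rewrite subr0 /push -lin_subf; apply: eq_lin => t /=.
  by rewrite tboundary_undec_left0 push_basis.
rewrite /= push_lin /push -!lin_subf; apply: eq_lin => t /=.
by rewrite tboundary_undec_left push_basis.
Qed.

Lemma edge_source_AW (X Y : sset) n (z : sprod (dec X) Y n) :
  lin (@edge_source X Y n) (AW_simplex z) =
  basis_elt (Tcell (add0n n) (vertex0 (z.1 : X n.+1)) z.2).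
Proof.
case: n z => [|n] z; first by rewrite AW_simplex0 lin_basis -vertex0_dec.
rewrite AW_simplexS linD lin_basis lin_push -[RHS]addr0; congr (_ + _).
  by rewrite -[in RHS]vertex0_dec.
by apply: etrans (lin0f _ _); apply: eq_lin => -[].
Qed.

Lemma tboundary_vertex0 (X Y : sset) n (x : X 0) (y : Y n.+1) :
  tboundary (Tcell (add0n n.+1) x y) =
  basis_elt (Tcell (add0n n) x (face ord0 y))
  - tens (add0n n) (basis_elt x) (pos_faces y).
Proof.
rewrite /tboundary /tboundary_left [lower_left _ _ _]/= add0r /tboundary_right.
by rewrite (lower_rightS _ _ _ (add0n n)) scale1r facesE tensBr tens_basis.
Qed.

(** By [AW_simplexS] and induction on the decalage of the left factor.  The face
    d_0 y of the term i = 0 cancels against the [edge_source] of the term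
    i = 1. *)
Lemma AW_boundary_simplex (X Y : sset) n (z : sprod X Y n.+1) :
  lin (@tboundary X Y n) (AW_simplex z) = lin (@AW_simplex X Y n) (faces z).
Proof.
have arith (V : zmodType) (b t w s : V) : b - t + (w - b - s) = w - (t + s).
  by rewrite addrC addrA [w - b - s]addrAC subrK opprD [RHS]addrA [RHS]addrAC.
elim: n X Y z => [|n IHn] X Y z.
all: rewrite AW_simplexS linD lin_basis lin_tboundary_undec_left.
all: rewrite edge_source_AW AW_simplex_natural tboundary_vertex0.
all: rewrite facesE linB lin_basis arith; congr (_ - _).
- rewrite /pos_faces !big_ord1 !scale1r lin_basis tens_basis addr0 AW_simplex0.
  by congr basis_elt; apply: Tcell_eq => //; rewrite -vertex0_dec.
- rewrite /undec_left_tboundary IHn /pos_faces /faces !raddf_sum /= -big_split /=.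
  apply: eq_bigr => i _; rewrite !raddfZsign /= -scalerDr; congr (_ *: _).
  rewrite !lin_basis tens_basis AW_simplexS.
  rewrite -[(face (lift ord0 i) z).1]/(face (lift ord0 i) z.1).
  by rewrite vertex0_face face0_face.
Qed.

(** * The homotopy *)

Definition ez (X Y : sset) n (z : sprod X Y n) : moore (sprod X Y) n :=
  shuffle (AW_simplex z).

Lemma shuffle_AW (X Y : sset) n (u : moore (sprod X Y) n) :
  shuffle (AW u) = lin (@ez X Y n) u.
Proof. exact: lin_lin. Qed.

Lemma ez_natural (X Y X' Y' : sset) (f : smap X X') (g : smap Y Y') n
    (z : sprod X Y n) :
  push (sprod_map f g n) (ez z) = ez (sprod_map f g n z).
Proof. by rewrite /ez -AW_simplex_natural -shuffle_natural. Qed.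

Lemma boundary_ez (X Y : sset) n (z : sprod X Y n.+1) :
  boundary (ez z) = lin (@ez X Y n) (faces z).
Proof. by rewrite /ez shuffle_boundary AW_boundary_simplex /shuffle lin_lin. Qed.

Lemma ez0 (X Y : sset) (z : sprod X Y 0) : ez z = basis_elt z.
Proof. by rewrite /ez AW_simplex0 /shuffle lin_basis shuffle_cell0; case: z. Qed.

Fixpoint const_simplex (X : sset) n : X 0%N -> X n :=
  if n is n'.+1 then fun v => degen ord0 (const_simplex n' v) else id.

Lemma face_const_simplex (X : sset) n (i : 'I_n.+2) (v : X 0%N) :
  face i (const_simplex n.+1 v) = const_simplex n v.
Proof.
elim: n i => [|n IHn] i; case: (unliftP ord0 i) => [j|] ->; rewrite ?face0_degen0 //.
  by rewrite [j]ord1 face1_degen0.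
case: (unliftP ord0 j) => [k|] ->; last by rewrite face1_degen0.
rewrite [const_simplex _ _]/= face_degen0.
by rewrite -[degen ord0 (const_simplex n v)]/(const_simplex n.+1 v) IHn.
Qed.

Lemma const_simplex_dec (X : sset) n (v : X 0%N) :
  const_simplex n (degen ord0 v : dec X 0) = const_simplex n.+1 v.
Proof.
elim: n => [//|n IHn]; rewrite [LHS]/= IHn.
rewrite -[LHS]/(degen (lift ord0 ord0) (degen ord0 (const_simplex n v))).
have := degen_degen (const_simplex n v) (leqnn 0) (leq0n n).
rewrite !inord0 /= => ->.
by congr (degen _ _); apply: val_inj; rewrite /= inordK.
Qed.

Definition collapse_left (X Y : sset) n (z : sprod X Y n) : sprod X Y n :=
  (const_simplex n (vertex0 z.1), z.2).

Lemma pos_faces_collapse_left (X Y : sset) n (z : sprod X Y n.+1) :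
  pos_faces (collapse_left z) = push (@collapse_left X Y n) (pos_faces z).
Proof.
rewrite /pos_faces raddf_sum; apply: eq_bigr => i _.
rewrite raddfZsign /= push_basis; congr (_ *: basis_elt _).
rewrite -[LHS]/(face (lift ord0 i) (const_simplex n.+1 _), _).
by rewrite face_const_simplex /collapse_left /= vertex0_face.
Qed.

Lemma collapse_left_dec (X Y : sset) n (z : sprod X Y n) :
  collapse_left (degen ord0 z : sprod (dec X) (dec Y) n) =
  degen ord0 (collapse_left z).
Proof. by rewrite /collapse_left /= vertex0_degen0 const_simplex_dec. Qed.

(** The operator R.  As s_0 contracts the decalage, g' s_0 relates g' to g, with
    an error g' s_0 D; subtracting s_0 E removes the summand that g' s_0
    shares with it, and only turns this error into R D. *)
Definition ez_cone (X Y : sset) n (z : sprod X Y n) : moore (sprod X Y) n.+1 :=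
  ez (degen ord0 z : sprod (dec X) (dec Y) n)
  - basis_elt (degen ord0 (collapse_left z)).

(** When p = 0 the identity is the only shuffle, and it degenerates the vertex
    all the way. *)
Lemma shuffle_vertex0 (X Y : sset) n (v : X 0%N) (y : Y n) :
  shuffle_cell (Tcell (add0n n) v y) =
  basis_elt ((const_simplex n v, y) : sprod X Y n).
Proof.
elim: n X Y v y => [|n IHn] X Y v y; first exact: shuffle_cell0.
rewrite shuffle_cell_first_step /first_step /first_step_left.
rewrite [lower_left _ _ _]/= add0r /first_step_right.
rewrite (lower_rightS _ _ _ (add0n n)) scale1r tens_basis lin_basis IHn.
by congr (basis_elt (_, _)); apply: const_simplex_dec.
Qed.

(** The summand i = 0 of the Alexander-Whitney map is isolated from the others,
    which are bounded by their numbers of shuffles. *)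
Lemma ez_collapse_left (X Y : sset) n (z : sprod X Y n) :
  exists2 c : 'I_n -> moore (sprod X Y) n,
    ez z = basis_elt (collapse_left z) + \sum_i c i
  & forall i, (diameter (c i) <= 'C(n, i.+1))%N.
Proof.
rewrite /ez /shuffle raddf_sum /= big_ord_recl lin_basis.
rewrite (@AW_term0 X Y) shuffle_vertex0; eexists; first by [].
by move=> i /=; rewrite lin_basis; apply: diameter_shuffle_cell.
Qed.

(** By [collapse_left_dec], the subtracted simplex is the term i = 0 of the
    other summand. *)
Lemma diameter_ez_cone (X Y : sset) n (z : sprod X Y n) :
  (diameter (ez_cone z) <= (2 ^ n).-1)%N.
Proof.
have [c + c_le] := ez_collapse_left (degen ord0 z : sprod (dec X) (dec Y) n).
rewrite /ez_cone => ->.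
rewrite collapse_left_dec addrC addKr (leq_trans (diameter_sum _ _ _)) //.
have -> : (2 ^ n).-1 = \sum_(i < n) 'C(n, i.+1).
  rewrite -[2%N]/(1 + 1)%N expnDn big_ord_recl bin0 !exp1n /=.
  by apply: eq_bigr => i _; rewrite !exp1n !muln1.
by apply: leq_sum => i _.
Qed.

Lemma ez_cone0 (X Y : sset) (z : sprod X Y 0) : ez_cone z = 0.
Proof. by rewrite /ez_cone ez0 subrr. Qed.

Lemma ez_cone_natural (X Y X' Y' : sset) (f : smap X X') (g : smap Y Y') n
    (z : sprod X Y n) :
  push (sprod_map f g n.+1) (ez_cone z) = ez_cone (sprod_map f g n z).
Proof.
have smap_vertex0 (A B : sset) (h : smap A B) m (x : A m) :
    h 0%N (vertex0 x) = vertex0 (h m x).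
  by elim: m x => // m IHm x; rewrite vertex0S IHm smap_face.
have smap_const (A B : sset) (h : smap A B) m (v : A 0%N) :
    h m (const_simplex m v) = const_simplex m (h 0%N v).
  by elim: m => //= m IHm; rewrite smap_degen IHm.
rewrite /ez_cone raddfB /= push_basis; congr (_ - basis_elt _).
  rewrite -[LHS]/(push (sprod_map (dec_map f) (dec_map g) n)
    (ez (degen ord0 z : sprod (dec X) (dec Y) n))) ez_natural.
  exact: (congr1 (@ez (dec X') (dec Y') n) (smap_degen (sprod_map f g) ord0 z)).
by rewrite /prod_degen /collapse_left /= !smap_degen smap_const smap_vertex0.
Qed.

(** Both summands are obtained from s_0, whose boundary is given by
    [pos_faces_degen0] and [boundary_degen0]; that [ez] is a chain map moves
    the boundary of the decalage across it. *)
Lemma boundary_ez_cone (X Y : sset) n (z : sprod X Y n.+1) :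
  boundary (ez_cone z) =
  lin (@ez_cone X Y n) (pos_faces z) + ez z - ez (z : sprod (dec X) (dec Y) n).
Proof.
have boundaryB (Z : sset) m (u v : moore Z m.+1) :
    boundary (u - v) = boundary u - boundary v.
  exact: raddfB.
(* No d_0 occurs on the right: [boundary_degen0] removes it. *)
have collapseE : boundary (basis_elt (degen ord0 (collapse_left z))) =
    lin (fun z => basis_elt (degen ord0 (collapse_left z))) (pos_faces z).
  by rewrite -push_basis boundary_degen0 lin_basis pos_faces_collapse_left push_push.
have dec_ez : lin (@pos_faces (sprod X Y) _)
      (ez (degen ord0 z : sprod (dec X) (dec Y) n.+1)) =
    ez (z : sprod (dec X) (dec Y) n) -
    lin (fun w : sprod X Y n => ez (degen ord0 w : sprod (dec X) (dec Y) n))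
      (pos_faces z).
  rewrite -[LHS]/(boundary (ez (degen ord0 z : sprod (dec X) (dec Y) n.+1))).
  rewrite boundary_ez.
  rewrite -[faces _]/(@pos_faces (sprod X Y) _ (degen ord0 z)) pos_faces_degen0.
  by rewrite linB lin_basis lin_push.
have face0_ez : push (@face (sprod X Y) n.+1 ord0)
    (ez (degen ord0 z : sprod (dec X) (dec Y) n.+1)) = ez z.
  apply: etrans (ez_natural (face0_map X) (face0_map Y)
    (degen ord0 z : sprod (dec X) (dec Y) n.+1)) _.
  exact: (congr1 (@ez X Y _) (face0_degen0 (z : sprod X Y _))).
rewrite /ez_cone lin_subf boundaryB collapseE boundaryE.
rewrite face0_ez dec_ez.
rewrite opprB addrCA -!addrA; congr (_ + _).
by rewrite [RHS]addrCA [- _ - _]addrC.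
Qed.

Fixpoint ez_homotopy n (X Y : sset) : sprod X Y n -> moore (sprod X Y) n.+1 :=
  if n is n'.+1 then
    fun z => - (@ez_homotopy n' (dec X) (dec Y) z : moore (sprod X Y) n'.+2)
             - ez_cone z
  else fun _ => 0.

Lemma ez_homotopy_natural n (X Y X' Y' : sset) (f : smap X X') (g : smap Y Y')
    (z : sprod X Y n) :
  push (sprod_map f g n.+1) (ez_homotopy z) = ez_homotopy (sprod_map f g n z).
Proof.
elim: n X Y X' Y' f g z => [|n IHn] X Y X' Y' f g z; first exact: raddf0.
rewrite [ez_homotopy _]/= raddfB raddfN /= ez_cone_natural; congr (- _ - _).
exact: (IHn _ _ _ _ (dec_map f) (dec_map g)).
Qed.

(** The terms P d_0 and R D cancel between the two compositions; the induction
    hypothesis on [dec X] and [dec Y] turns the remaining occurrences of P' into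
    id - g', and [boundary_ez_cone] supplies g' - g. *)
Lemma ez_homotopyP n (X Y : sset) (z : sprod X Y n.+1) :
  lin (@ez_homotopy n X Y) (faces z) + boundary (ez_homotopy z) = basis_elt z - ez z.
Proof.
have boundaryB (Z : sset) m (u v : moore Z m.+1) :
    boundary (- u - v) = - boundary u - boundary v.
  by rewrite /boundary linB raddfN.
elim: n X Y z => [|n IHn] X Y z.
  have -> : lin (@ez_homotopy 0 X Y) (faces z) = 0 by apply: lin0f.
  rewrite [ez_homotopy z]/= boundaryB boundary_ez_cone.
  have -> : lin (@ez_cone X Y 0) (pos_faces z) = 0.
    by apply: etrans (eq_lin _ (@ez_cone0 X Y)) (lin0f _ _).
  by rewrite /boundary lin0 oppr0 !add0r opprB (@ez0 (dec X) (dec Y)).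
have arith (V : zmodType) (a b c d e e' i : V) : b + d = i - e' ->
    a - (- b - c) + (- (a - d) - (c + e - e')) = i - e.
  move=> bd; have -> : i = b + d + e' by rewrite bd subrK.
  rewrite -[- b - c]opprD opprK !opprB addrACA [a + _]addrC subrK.
  rewrite [e' - _]addrC [b + c + _]addrA opprD [b + c + _]addrA addrK.
  by rewrite [b - e + e']addrAC !addrA [d + b]addrC.
rewrite facesE linB lin_basis.
have -> : lin (@ez_homotopy n.+1 X Y) (pos_faces z) =
    - lin (@ez_homotopy n (dec X) (dec Y)) (@faces (sprod (dec X) (dec Y)) n z)
    - lin (@ez_cone X Y n.+1) (pos_faces z).
  by rewrite -lin_oppf -lin_subf.
have -> : boundary (ez_homotopy z) =
    - (@ez_homotopy n.+1 X Y (face ord0 z)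
       - boundary (@ez_homotopy n.+1 (dec X) (dec Y) z))
    - (lin (@ez_cone X Y n.+1) (pos_faces z) + ez z
       - @ez (dec X) (dec Y) n.+1 z).
  rewrite [ez_homotopy z]/= boundaryB boundary_ez_cone boundaryE.
  congr (- (_ - _) - _).
  exact: (ez_homotopy_natural (face0_map X) (face0_map Y)).
apply: arith; exact: (IHn (dec X) (dec Y) z).
Qed.

(** The bound satisfies b(n+1) = b(n) + 2^(n+1) - 1. *)
Lemma diameter_ez_homotopy n (X Y : sset) (z : sprod X Y n) :
  (diameter (ez_homotopy z) <= 2 ^ n.+1 - n.+2)%N.
Proof.
elim: n X Y z => [|n IHn] X Y z; first by rewrite diameter0.
rewrite [ez_homotopy _]/= (leq_trans (diameterD _ _)) // !diameterN.
apply: leq_trans (leq_add (IHn (dec X) (dec Y) z) (diameter_ez_cone z)) _.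
have := ltn_expl n.+1 (ltnSn 1); rewrite !expnS; lia.
Qed.

Definition EZ_family : prod_family := fun X Y n => lin (@ez_homotopy n X Y).

Local Close Scope ring_scope.

Theorem theorem4p4 :
  exists (P : prod_family) (delta_EZ : nat -> nat),
    [/\ natural_family P,
        forall X Y : sset,
          chain_homotopy (fun n u => shuffle (AW u)) (fun n u => u) (P X Y),
        uniformly_controlled P delta_EZ
      & [/\ delta_EZ 0 = 0, delta_EZ 1 = 1, delta_EZ 2 = 4,
            delta_EZ 3 = 11 & delta_EZ 4 = 26]].
Proof.
exists EZ_family, (fun k => 2 ^ k.+1 - k.+2); split=> //.
- move=> X X' Y Y' f g n u; rewrite /moore_map -/(push _ _) /= push_lin lin_push.
  by apply: eq_lin => z; apply: ez_homotopy_natural.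
- move=> X Y; split=> [u|n u]; rewrite shuffle_AW /=.
    rewrite (eq_lin _ (@ez0 X Y)) lin_id subrr /boundary lin_lin.
    by apply: etrans (lin0f _ u); apply: eq_lin => z; apply: lin0.
  rewrite /boundary !lin_lin -lin_addf -[X in (X - _)%R](lin_id u) -lin_subf.
  apply: eq_lin => z; rewrite -ez_homotopyP; congr (lin _ _ + _)%R.
- move=> X Y k i c ik /=; rewrite lin_basis (leq_trans (diameter_ez_homotopy c)) //.
  (* The control at k also has to bound the diameters in degrees i < k. *)
  rewrite -(subnK ik); elim: (k - i) => [|m IHm] //; apply: leq_trans IHm _.
  by have := expn_gt0 2 (m + i).+1; rewrite addSn [2 ^ (m + i).+2]expnS; lia.
Qed.
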